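(* If a star-$\epsilon$-space $X$ is the union of less than $\mathrm{cov}(\mathcal{M})$ many $S_1(\Omega,\Gamma)$ spaces, then $X$ is star-Rothberger.
   Context: A space is a topological space. $\mathrm{cov}(\mathcal{M})$ is the minimum cardinality of a family of meager subsets of $\mathbb{R}$ that covers $\mathbb{R}$; equivalently, the minimum cardinality of a set $F\subseteq\mathbb{N}^{\mathbb{N}}$ such that for every $g\in\mathbb{N}^{\mathbb{N}}$ there is an $f\in F$ with $f(n)\neq g(n)$ for all but finitely many $n$. An open cover $\mathcal{U}$ of a space $Z$ is an $\omega$-cover if $Z\notin\mathcal{U}$ and for each finite subset $F$ of $Z$ there is a $U\in\mathcal{U}$ with $F\subseteq U$; it is a $\gamma$-cover if it is infinite and each point of $Z$ fails to belong to at most finitely many members of $\mathcal{U}$. $\Omega$ and $\Gamma$ denote the collections of all $\omega$-covers and all $\gamma$-covers, respectively. $Z$ is an $S_1(\Omega,\Gamma)$ space if for each sequence $(\mathcal{U}_n)_{n\in\mathbb{N}}$ of $\omega$-covers of $Z$ there is a sequence $(V_n)$ with $V_n\in\mathcal{U}_n$ for each $n$ such that $\{V_n : n\in\mathbb{N}\}$ is a $\gamma$-cover of $Z$. For $A\subseteq X$ and a collection $\mathcal{P}$ of subsets of $X$, $St(A,\mathcal{P})=\bigcup\{B\in\mathcal{P} : A\cap B\neq\emptyset\}$. A space $X$ is a star-$\epsilon$-space if for every open cover $\mathcal{U}$ of $X$ there is a countable set $\mathcal{V}\subseteq\mathcal{U}$ such that $\{St(V,\mathcal{U}) : V\in\mathcal{V}\}$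 is an $\omega$-cover of $X$. $X$ is star-Rothberger if for each sequence $(\mathcal{U}_n)_{n\in\mathbb{N}}$ of open covers of $X$ there is a sequence $(V_n)$ with $V_n\in\mathcal{U}_n$ for each $n$ such that $\{St(V_n,\mathcal{U}_n) : n\in\mathbb{N}\}$ is an open cover of $X$. The spaces whose union is $X$ are subspaces of $X$. *)

(* Defs.v *)
From mathcomp Require Import all_boot all_order all_algebra.
From mathcomp Require Import all_classical all_reals.
From mathcomp Require Import topology normedtype.
Import numFieldNormedType.Exports.

Set Implicit Arguments.
Unset Strict Implicit.
Unset Printing Implicit Defensive.

Local Open Scope classical_set_scope.
Local Open Scope card_scope.

Section Meager.
Variable T : topologicalType.

Definition nowhere_dense (A : set T) : Prop := interior (closure A) = set0.

Definition meager (A : set T) : Prop :=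
  exists2 F : nat -> set T,
    forall n, nowhere_dense (F n) & A = \bigcup_n F n.

Definition meager_cover (G : set (set T)) : Prop :=
  (forall M, G M -> meager M) /\ \bigcup_(M in G) M = setT.

End Meager.

Definition card_lt (S T : Type) (A : set S) (B : set T) : Prop :=
  A #<= B /\ ~ (B #<= A).

(* |A| < cov(M).  As cov(M) is the least cardinality of a cover of the real
   line by meager sets, this says that |A| is less than the cardinality of
   every such cover. *)
Definition lt_cov_meager (R : realType) (S : Type) (A : set S) : Prop :=
  forall G : set (set R), meager_cover G -> card_lt A G.

Section Covers.
Variable Z : topologicalType.
Implicit Types U : set (set Z).

Definition open_cover U : Prop :=
  (forall A, U A -> open A) /\ \bigcup_(A in U) A = setT.

Definition weak_omega_cover U : Prop :=
  open_cover U /\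
  forall F : set Z, finite_set F -> exists2 A, U A & F `<=` A.

Definition omega_cover U : Prop := weak_omega_cover U /\ ~ U setT.

Definition gamma_cover U : Prop :=
  [/\ open_cover U, infinite_set U &
      forall z : Z, finite_set [set A | U A /\ ~ A z]].

Definition S1_Omega_Gamma : Prop :=
  forall U : nat -> set (set Z), (forall n, omega_cover (U n)) ->
  exists2 V : nat -> set Z, forall n, U n (V n) & gamma_cover (range V).

End Covers.

Section Star.
Variable X : topologicalType.

Definition St (A : set X) (P : set (set X)) : set X :=
  \bigcup_(B in [set B | P B /\ A `&` B !=set0]) B.

(* The requirement of omega_cover that the whole space not be a member is
   dropped here.  With it no space would qualify: for U = [set setT] the only
   possible star is setT.  Dropping it gives a condition implied by the literal
   one, namely that every finite set lies in some St W U with W in V. *)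
Definition star_epsilon_space : Prop :=
  forall U : set (set X), open_cover U ->
  exists V : set (set X), [/\ V `<=` U, countable V &
    weak_omega_cover [set St W U | W in V]].

Definition star_Rothberger : Prop :=
  forall U : nat -> set (set X), (forall n, open_cover (U n)) ->
  exists2 V : nat -> set X, forall n, U n (V n) &
    open_cover (range (fun n => St (V n) (U n))).

End Star.

(* Main.v *)
(* Fix countable subfamilies of the n-th cover whose stars form an omega-cover,
   enumerated by m.  In each S_1(Omega, Gamma) piece A there is a function f_A
   such that every point of A lies in the f_A(n)-th star at level n for all but
   finitely many n.  As there are fewer than cov(M) functions f_A, a single g
   agrees infinitely often with each of them, and the g(n)-th members of the
   covers witness that X is star-Rothberger. *)
Require Import Defs.
From mathcomp Require Import all_boot all_order all_algebra.
From mathcomp Require Import all_classical all_reals.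
From mathcomp Require Import topology normedtype.
Import Order.TTheory GRing.Theory Num.Theory numFieldNormedType.Exports.

Local Open Scope classical_set_scope.

Section Oscillation.
Variable R : realType.
Local Open Scope ring_scope.

(* On each interval [j / (n + 1), (j + 1) / (n + 1)[ the function osc ^~ n takes
   every natural number as a value on some open subinterval. *)
Definition osc (x : R) (n : nat) : nat :=
  let y := x * n.+1%:R in (Num.trunc (y - (Num.floor y)%:~R)^-1).-1.

(** The fractional part of [x * n.+1%:R] lies strictly between 1/(m+2) and 1/(m+1), so its inverse
    truncates to m+1; the predecessor in [osc] makes the value 0 available too. *)
Lemma oscE (j : int) (m n : nat) (x : R) :
  j%:~R + m.+2%:R^-1 < x * n.+1%:R < j%:~R + m.+1%:R^-1 -> osc x n = m.
Proof.
move=> /andP[jx xj]; rewrite /osc.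
set y := x * _ in jx xj *.
have m2V : (0 : R) < m.+2%:R^-1 by rewrite invr_gt0 ltr0n.
have m1V : (m.+1%:R^-1 : R) <= 1 by rewrite invf_le1 ?ltr0n// ler1n.
have m1V0 : (0 : R) < m.+1%:R^-1 by rewrite invr_gt0 ltr0n.
have jy : j%:~R < y by apply: lt_trans jx; rewrite ltrDl.
have -> : Num.floor y = j.
  apply: floor_def; rewrite ltW//= intrD mulr1z.
  by apply: lt_le_trans xj _; rewrite lerD2l.
have d0 : 0 < y - j%:~R by rewrite subr_gt0.
rewrite (_ : Num.trunc _ = m.+1)//; apply: truncn_def; apply/andP; split.
  by rewrite -[leLHS]invrK lef_pV2 ?posrE// lerBlDl ltW.
by rewrite -[ltRHS]invrK ltf_pV2 ?posrE// ltrBrDl.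
Qed.

Lemma osc_avoid_nowhere_dense (f : nat -> nat) (k : nat) :
  nowhere_dense [set x : R | forall n, (k <= n)%N -> osc x n <> f n].
Proof.
rewrite /nowhere_dense -subset0 => x /= /nbhs_ballP[e /= e0 xe].
(* As 2/(n+1) < e, the grid interval right after the one containing [x] lies in the ball; on its
   subinterval ]a, b[ the value of [osc] at [n] is [f n]. *)
pose n := maxn k (Num.trunc (2 / e)).
have n0 : (0 : R) < n.+1%:R by rewrite ltr0n.
have ne : 2 < e * n.+1%:R.
  rewrite mulrC -ltr_pdivrMr//; apply: lt_le_trans (truncnS_gt _) _.
  by rewrite ler_nat ltnS leq_maxr.
pose j := Num.floor (x * n.+1%:R) + 1.
have /andP[jx xj] := floor_itv (x * n.+1%:R).
have jE : j%:~R = (Num.floor (x * n.+1%:R))%:~R + 1 :> R.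
  by rewrite intrD mulr1z.
rewrite -/j in xj.
pose m := f n.
have m2V : (0 : R) < m.+2%:R^-1 by rewrite invr_gt0 ltr0n.
have m12 : (m.+2%:R^-1 : R) < m.+1%:R^-1.
  by rewrite ltf_pV2 ?posrE ?ltr0n// ltr_nat.
have m1V : (m.+1%:R^-1 : R) <= 1 by rewrite invf_le1 ?ltr0n// ler1n.
pose a := (j%:~R + m.+2%:R^-1) / n.+1%:R : R.
pose b := (j%:~R + m.+1%:R^-1) / n.+1%:R : R.
have ab : a < b by rewrite ltr_pM2r ?invr_gt0// ltrD2l.
have xa : x < a by rewrite ltr_pdivlMr// (lt_trans xj)// ltrDl.
have bx : b < x + e.
  rewrite ltr_pdivrMr// mulrDl jE -addrA ler_ltD//.
  by apply: le_lt_trans ne; rewrite -[2]/(1 + 1) lerD2l.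
have yab : (a + b) / 2 \in `]a, b[ by rewrite in_itv /= !midf_lt.
have xey : ball x e ((a + b) / 2).
  have := yab; rewrite in_itv /= => /andP[ay yb].
  rewrite /ball /= distrC ltr_distl (lt_trans yb bx) andbT.
  by apply: lt_trans (lt_trans xa ay); rewrite ltrBlDr ltrDl.
have [z [/= zf]] := xe _ xey _ (near_in_itvoo yab).
rewrite in_itv /= ltr_pdivrMr// ltr_pdivlMr// => zab.
exact: (zf n (leq_maxl _ _) (oscE _ _ _ _ zab)).
Qed.

End Oscillation.

(** The reals [x] whose [osc] sequence agrees with [f A] only finitely often form a meager set.
    Fewer than cov(M) such sets miss some [x], whose sequence is [g]. *)
Lemma lt_cov_meager_infinitely_often_equal (R : realType) (S : Type)
    (P : set S) (f : S -> nat -> nat) : lt_cov_meager R P ->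
  exists g : nat -> nat,
    forall A, P A -> forall k, exists2 n, (k <= n)%N & g n = f A n.
Proof.
move=> ltP.
pose E (A : S) (k : nat) :=
  [set x : R | forall n, (k <= n)%N -> osc R x n <> f A n].
pose M (A : S) := \bigcup_k E A k.
suff [x xM] : exists x, forall A, P A -> ~ M A x.
  exists (osc R x) => A PA k; apply: contrapT => kP; apply: (xM A PA).
  by exists k => // n kn xn; apply: kP; exists n.
apply: contrapT => noX.
have [|_] := ltP (M @` P); last by apply; exact: card_image_le.
split=> [_ [A _ <-]|].
  by exists (E A) => // k; exact: osc_avoid_nowhere_dense.
rewrite -subTset => x _; apply: contrapT => xM; apply: noX; exists x => A PA AX.
by apply: xM; exists (M A) => //; exists A.
Qed.

(* Selecting from finite intersections of the first covers, and reading off the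
   k-th coordinate of a selection that is new at a stage [n >= k], makes the
   gamma-cover property (about sets) hold for the indexing. *)
Lemma S1_Omega_Gamma_eventually (Z : topologicalType)
    (O : nat -> nat -> set Z) :
  S1_Omega_Gamma Z ->
  (forall n m, open (O n m)) ->
  (forall n (F : set Z), finite_set F -> exists m, F `<=` O n m) ->
  exists f : nat -> nat,
    forall z, exists N, forall n, (N <= n)%N -> O n (f n) z.
Proof.
move=> S1 Oopen Ofin.
have [/choice[f fT]|/existsNP[n0 n0T]] :=
  pselect (forall n, exists m, O n m = setT).
  by exists f => z; exists 0%N => n _; rewrite fT.
pose I (s : nat -> nat) n := \bigcap_(i in `I_n) O i (s i).
(* The shift puts level [n0], where no set is the whole space, into every intersection, so [setT] is
   never in [W n]. *)
pose W n := [set I s (n0 + n).+1 | s in [set: nat -> nat]].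
have Wfin n (F : set Z) : finite_set F -> exists2 A, W n A & F `<=` A.
  move=> Ffin; have /choice[s Fs] i := Ofin i F Ffin.
  exists (I s (n0 + n).+1); first by exists s.
  by move=> z Fz i _; exact: Fs.
have Womega n : omega_cover (W n).
  split; first split; first split; [| |exact: Wfin|].
  - move=> _ [s _ <-]; rewrite /I bigcap_mkord; apply: big_ind => //.
      exact: openT.
    exact: openI.
  - rewrite -subTset => z _; have [A WA zA] := Wfin n _ (finite_set1 z).
    by exists A => //; exact: zA.
  - move=> [s _ IT]; apply: n0T; exists (s n0); rewrite -subTset -IT => z.
    by apply; rewrite /= ltnS leq_addr.
have [V WV [_ Vinf Vgamma]] := S1 _ Womega.
have /choice[s sV] : forall n, exists s, I s (n0 + n).+1 = V n.
  by move=> n; have [s _ <-] := WV n; exists s.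
have /choice[h hV] : forall k, exists n, ~ (V @` `I_k) (V n).
  move=> k; have [_ [[n _ <-] Vn]] := infinite_setN0
    (infinite_setD Vinf (finite_image V (finite_II k))).
  by exists n.
have hge k : (k <= h k)%N.
  by rewrite leqNgt; apply/negP => hk; apply: (hV k); exists (h k).
exists (fun k => s (h k) k) => z.
(* [N] exceeds a chosen index of each of the finitely many members omitting [z]. For k >= N, the set
   [V (h k)] is new at stage k, hence contains [z]. *)
have [N VN] : exists N, [set A | range V A /\ ~ A z] `<=` V @` `I_N.
  have /choice[idx idxV] : forall A, exists i, range V A -> V i = A.
    move=> A; have [[i _ iA]|nA] := pselect (range V A); first by exists i.
    by exists 0%N => /nA.
  have /finite_seqP[l lE] := finite_image idx (Vgamma z).
  exists (\max_(i <- l) i).+1 => A AVz; exists (idx A); last exact: idxV AVz.1.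
  have lA : [set` l] (idx A) by rewrite -lE; exists A.
  by rewrite /= ltnS; exact: leq_bigmax_seq.
exists N => k Nk.
have : V (h k) z.
  apply: contrapT => Vz; have [|i /= iN iV] := VN (V (h k)).
    by split=> //; exists (h k).
  by apply: (hV k); exists i => //=; exact: leq_trans iN Nk.
rewrite -sV; apply; rewrite /= ltnS; apply: leq_trans (hge k) _.
exact: leq_addl.
Qed.

Lemma open_St (X : topologicalType) (A : set X) (U : set (set X)) :
  open_cover U -> open (St A U).
Proof. by move=> [Uo _]; apply: bigcup_open => B [/Uo]. Qed.

Lemma star_epsilon_space_sequence (X : topologicalType) (U : set (set X)) :
  star_epsilon_space X -> open_cover U ->
  exists W : nat -> set X, (forall m, U (W m)) /\
    forall F : set X, finite_set F -> exists m, F `<=` St (W m) U.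
Proof.
move=> Xe /Xe[V [VU Vcount [_ Vfin]]].
(* Some star contains the empty set, so [V] has a member [A]; it replaces the values of the
   enumeration outside [V]. *)
have [_ [A VA _] _] := Vfin _ (finite_set0 X).
have [W VW] : exists W : nat -> set X, W @` setT = V.
  have /pcard_surjP[W WV] := Vcount.
  exists (fun m => if W m \in V then W m else A).
  apply/seteqP; split=> [_ [m _ <-]|B VB].
    by case: ifPn => //; exact: set_mem.
  by have [m _ WB] := WV B VB; exists m; rewrite // WB mem_set.
exists W; split=> [m|F /Vfin[_ [B + <-] FB]].
  by apply: VU; rewrite -VW; exists m.
by rewrite -VW => -[m _ WB]; exists m; rewrite WB.
Qed.

(* The coercion set_type turns A : set X into the subspace A, with the topology
   induced by the inclusion into X. *)
Theorem theorem4p14 (R : realType) (X : topologicalType) (P : set (set X)) :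
  star_epsilon_space X ->
  (forall A : set X, P A -> S1_Omega_Gamma (set_type A)) ->
  \bigcup_(A in P) A = setT ->
  lt_cov_meager R P ->
  star_Rothberger X.
Proof.
move=> Xe PS1 PT ltP U Ucover.
have /choice[W WP] n := star_epsilon_space_sequence _ _ Xe (Ucover n).
pose O n m := St (W n m) (U n).
have /choice[f fP] : forall A, exists f : nat -> nat, P A ->
    forall x, A x -> exists N, forall n, (N <= n)%N -> O n (f n) x.
  move=> A; have [PA|nPA] := pselect (P A); last by exists id.
  (* The traces of the stars on [A] still capture finite sets, since a finite subset of the subspace
     has a finite image in [X]. *)
  have [|n F Ffin|f fP] := S1_Omega_Gamma_eventually _
      (fun n m => @set_val X A @^-1` O n m) (PS1 A PA).
  - by move=> n m; apply: open_comp (open_St _ _ _ (Ucover n)) => z _;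
      exact: initial_continuous.
  - have [m Fm] := (WP n).2 _ (finite_image set_val Ffin).
    by exists m => z Fz; apply: Fm; exists z.
  - exists f => _ x Ax; have [N NP] := fP (SigSub (mem_set Ax)).
    by exists N => n /NP.
have [g gP] := lt_cov_meager_infinitely_often_equal _ _ _ f ltP.
exists (fun n => W n (g n)) => [n|]; first exact: (WP n).1.
split=> [_ [n _ <-]|]; first exact: open_St.
rewrite -subTset => x _.
have [A PA Ax] : (\bigcup_(A in P) A) x by rewrite PT.
have [N NP] := fP A PA x Ax; have [n Nn gf] := gP A PA N.
by exists (St (W n (g n)) (U n)); [exists n|rewrite gf; exact: NP].
Qed.
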